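(* Let $(X,T)$ be a t.d.s. Then $(K(X),T_K)$ is diam-mean equicontinuous if and only if $(K(X),T_K)$ is mean equicontinuous.
   Context: A t.d.s. (topological dynamical system) is a pair $(X,T)$ where $X$ is a non-empty compact metric space with metric $d$ and $T\colon X\to X$ is continuous. $K(X)$ is the space of non-empty closed subsets of $X$ with the Hausdorff metric $d_H(A,B)=\max\{\max_{x\in A}\min_{y\in B}d(x,y),\max_{y\in B}\min_{x\in A}d(x,y)\}$ (a compact metric space), and $T_K\colon K(X)\to K(X)$, $T_K(C)=T(C)$, is the induced continuous map; so $(K(X),T_K)$ is a t.d.s. For a t.d.s. $(Z,R)$ with metric $\rho$: a point $x\in Z$ is mean equicontinuous if for every $\varepsilon>0$ there is $\delta>0$ such that for every $y\in Z$ with $\rho(x,y)<\delta$, $\limsup_{n\to\infty}\frac1n\sum_{i=0}^{n-1}\rho(R^ix,R^iy)<\varepsilon$; it is diam-mean equicontinuous if for every $\varepsilon>0$ there is a neighbourhood $U$ of $x$ with $\limsup_{n\to\infty}\frac1n\sum_{i=0}^{n-1}\operatorname{diam}(R^iU)<\varepsilon$. $(Z,R)$ is mean (resp. diam-mean) equicontinuous if all its points are. *)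

(* Defs.v *)
From HB Require Import structures.
From mathcomp Require Import all_boot all_order all_algebra.
From mathcomp Require Import all_classical all_reals all_analysis.

Set Implicit Arguments.
Unset Strict Implicit.
Unset Printing Implicit Defensive.

Import Order.TTheory GRing.Theory Num.Theory.
Import numFieldNormedType.Exports.

Local Open Scope classical_set_scope.
Local Open Scope ring_scope.

Section equicontinuity.
Context {R : realType} {Z : metricType R}.

(* Extended-real valued, so that unbounded sets need no convention; it is only
   meant for non-empty A (it is -oo on the empty set). *)
Definition diam (A : set Z) : \bar R :=
  ereal_sup [set (mdist p.1 p.2)%:E | p in A `*` A].

Variable f : Z -> Z.

(* The term at n = 0 of the sequences of averages is 0 (as 0^-1 = 0); it does
   not affect the limsup. *)
Definition mean_equicontinuous_at (x : Z) : Prop :=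
  forall e : R, 0 < e -> exists2 d : R, 0 < d &
    forall y : Z, mdist x y < d ->
      (limn_esup (fun n : nat =>
         (n%:R^-1 * \sum_(i < n) mdist (iter i f x) (iter i f y))%:E) < e%:E)%E.

Definition diam_mean_equicontinuous_at (x : Z) : Prop :=
  forall e : R, 0 < e -> exists2 U : set Z, nbhs x U &
    (limn_esup (fun n : nat =>
       (n%:R^-1)%:E * \sum_(i < n) diam (iter i f @` U)) < e%:E)%E.

Definition mean_equicontinuous : Prop := forall x, mean_equicontinuous_at x.

Definition diam_mean_equicontinuous : Prop :=
  forall x, diam_mean_equicontinuous_at x.

End equicontinuity.

Section hausdorff_distance.
Context {R : realType} {X : metricType R}.
Implicit Types (x y : X) (A B C : set X).

Definition dist_to x B : R := inf [set mdist x y | y in B].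

Definition excess A B : R := sup [set dist_to x B | x in A].

(* For non-empty compact sets these sups and infs are attained, so this is
   max {max_(x in A) min_(y in B) d(x, y), max_(y in B) min_(x in A) d(y, x)}. *)
Definition hausdorff_dist A B : R := Num.max (excess A B) (excess B A).

Lemma dist_to_le x y B : B y -> dist_to x B <= mdist x y.
Proof.
move=> By; apply: ge_inf; last by exists y.
by exists 0 => _ [z _ <-]; exact: mdist_ge0.
Qed.

Lemma le_dist_to x B (c : R) : B !=set0 ->
  (forall y, B y -> c <= mdist x y) -> c <= dist_to x B.
Proof.
move=> [y By] cB; apply: lb_le_inf; first by exists (mdist x y); exists y.
by move=> _ [z Bz <-]; exact: cB.
Qed.

Lemma excess_le A B (c : R) : A !=set0 ->
  (forall x, A x -> dist_to x B <= c) -> excess A B <= c.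
Proof.
move=> [x Ax] Ac; apply: ge_sup; first by exists (dist_to x B); exists x.
by move=> _ [z Az <-]; exact: Ac.
Qed.

Lemma mdist_continuous x : continuous (mdist x : X -> R).
Proof.
move=> y; apply/cvgrPdist_lt => e e0.
near=> z; have yz : mdist y z < e.
  by near: z; apply/nbhs_ballP; exists e => //= z; rewrite ballEmdist.
apply: le_lt_trans yz; rewrite ler_distl.
rewrite lerBlDr metric_triangle /= (metric_sym y z).
exact: metric_triangle.
Unshelve. all: by end_near. Qed.

Lemma compact_mdist_bounded : compact [set: X] ->
  exists M : R, forall x y, mdist x y <= M.
Proof.
move=> cX; have [[x0 _]|X0] := pselect ([set: X] !=set0); last first.
  by exists 0 => x; exfalso; apply: X0; exists x.
have [||c _ cM] := @compact_EVT_max X R (mdist x0) setT _ cX.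
- by exists x0.
- by apply: continuous_subspaceT; exact: mdist_continuous.
exists (mdist x0 c + mdist x0 c) => x y.
rewrite (le_trans (metric_triangle x x0 y))// metric_sym.
by rewrite lerD// cM// in_setT.
Qed.

Hypothesis cX : compact [set: X].

Lemma le_excess x A B : A x -> B !=set0 -> dist_to x B <= excess A B.
Proof.
move=> Ax [y By]; apply: ub_le_sup; last by exists x.
have [M XM] := compact_mdist_bounded cX.
by exists M => _ [z Az <-]; rewrite (le_trans (dist_to_le z By)).
Qed.

Lemma excess_refl A : A !=set0 -> excess A A = 0.
Proof.
move=> A0; apply/eqP; rewrite eq_le; apply/andP; split.
  by apply: excess_le => // x Ax; rewrite -(mdistxx x) dist_to_le.
have [x Ax] := A0; apply: le_trans (le_excess Ax A0).
by apply: le_dist_to => // y _; exact: mdist_ge0.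
Qed.

Lemma excess_triangle A B C : A !=set0 -> B !=set0 -> C !=set0 ->
  excess A C <= excess A B + excess B C.
Proof.
move=> A0 B0 C0; apply: excess_le => // x Ax.
rewrite -lerBlDr; apply: le_trans (le_excess Ax B0).
apply: le_dist_to => // y By; rewrite lerBlDr.
apply: (@le_trans _ _ (mdist x y + dist_to y C)); last first.
  by rewrite lerD2l le_excess.
rewrite -lerBlDl; apply: le_dist_to => // z Cz; rewrite lerBlDl.
exact: le_trans (dist_to_le x Cz) (metric_triangle x y z).
Qed.

Lemma excess_le0_subset A B : B !=set0 -> closed B ->
  excess A B <= 0 -> A `<=` B.
Proof.
move=> [b Bb] clB AB0 x Ax; apply: clB => U /nbhs_ballP[e /= e0]; rewrite ballEmdist => eU.
have xB : dist_to x B < e.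
  by rewrite (le_lt_trans _ e0)// (le_trans _ AB0)// le_excess//; exists b.
have [||_ [y By <-] xye] := @inf_lt _ [set mdist x y | y in B] e.
- by exists (mdist x b); exists b.
- exact: xB.
by exists y; split => //; exact: eU.
Qed.

End hausdorff_distance.

(* The space K(X). Compactness of X is a parameter because it is what makes
   the Hausdorff distance finite, hence a metric. *)
Record hyperspace {R : realType} {X : metricType R} (cX : compact [set: X]) :=
  Hyperspace {
    hyperset :> set X ;
    hyperset_closed : closed hyperset ;
    hyperset_nonempty : hyperset !=set0 }.

Section hyperspace_metric.
Context {R : realType} {X : metricType R} (cX : compact [set: X]).
Notation K := (hyperspace cX).
Implicit Types A B C : K.

Lemma hyperspace_eq A B : A = B :> set X -> A = B.
Proof.
case: A B => [A Acl A0] [B Bcl B0] /= AB; move: Acl A0 Bcl B0.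
by rewrite AB => *; congr Hyperspace; exact: Prop_irrelevance.
Qed.

Let hdist A B : R := hausdorff_dist A B.

Let hdistxx A : hdist A A = 0.
Proof.
by rewrite /hdist /hausdorff_dist (excess_refl cX (hyperset_nonempty A)) maxxx.
Qed.

Let hdist_positivity A B : hdist A B = 0 -> A = B.
Proof.
move=> AB0; have : hdist A B <= 0 by rewrite AB0.
rewrite /hdist /hausdorff_dist ge_max => /andP[AB BA].
apply: hyperspace_eq; apply/seteqP; split.
- exact: (excess_le0_subset cX (hyperset_nonempty B) (@hyperset_closed _ _ _ B)).
- exact: (excess_le0_subset cX (hyperset_nonempty A) (@hyperset_closed _ _ _ A)).
Qed.

Let hdist_sym A B : hdist A B = hdist B A.
Proof. by rewrite /hdist /hausdorff_dist maxC. Qed.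

Let hdist_triangle B A C : hdist A C <= hdist A B + hdist B C.
Proof.
have tri (A' B' C' : K) := excess_triangle cX (hyperset_nonempty A')
  (hyperset_nonempty B') (hyperset_nonempty C').
rewrite /hdist /hausdorff_dist ge_max; apply/andP; split.
  by rewrite (le_trans (tri A B C))// lerD// le_max lexx.
by rewrite (le_trans (tri C B A))// addrC lerD// le_max lexx orbT.
Qed.

HB.instance Definition _ := gen_eqMixin K.
HB.instance Definition _ := gen_choiceMixin K.
HB.instance Definition _ := @isMetric.Build R K
  hdist hdistxx hdist_positivity hdist_sym hdist_triangle.

Lemma hyperspace_mdistE A B : mdist A B = hausdorff_dist A B.
Proof. by []. Qed.

Variables (T : X -> X) (cT : continuous T).

Lemma image_hyperset_closed A : closed (T @` A).
Proof.
apply: compact_closed; first exact: metric_hausdorff.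
apply: continuous_compact; first exact: continuous_subspaceT.
by apply: subclosed_compact cX _ => //; exact: hyperset_closed.
Qed.

Lemma image_hyperset_nonempty A : T @` A !=set0.
Proof. by have [x Ax] := hyperset_nonempty A; exists (T x); exists x. Qed.

Definition hyperspace_map A : K :=
  Hyperspace cX (image_hyperset_closed (A := A)) (image_hyperset_nonempty A).

End hyperspace_metric.

Arguments hyperspace_map {R X} cX {T} cT A.

(* Main.v *)
Require Import Defs.
From HB Require Import structures.
From mathcomp Require Import all_boot all_order all_algebra.
From mathcomp Require Import all_classical all_reals all_analysis.
From mathcomp Require Import finmap lra.

(** That diam-mean equicontinuity implies mean equicontinuity holds in any
    system: the diameters of the images of a neighbourhood of [x] dominate the
    distances between the orbits of [x] and of any point of the neighbourhood.

    Conversely, diam-mean equicontinuity at [x] amounts to having, for each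
    [e], one sequence [g] of small upper mean which bounds, at all times at
    once, the distance between the orbit of [x] and those of all points near
    [x]; mean equicontinuity only gives one such sequence per nearby point. On
    the hyperspace a uniform bound near a set [A] is assembled from finitely
    many pairs of nearby sets.

    - The excess of [T^i B] over [T^i A] is monotone in [B], hence it is worst
      for the largest admissible set, the closed [r]-thickening of [A], which
      is itself a point of the hyperspace at distance at most [r] from [A]
      ([excess_image_envelope]).

    - For the excess of [T^i A] over [T^i B], [A] is replaced by a finite net
      [F] of [A], which is close to [A] in the hyperspace, so that the excess
      of [T^i A] over [T^i F] has small upper mean. Each point of [F] has a
      point of [B] next to it, and [F] is finite, so it suffices to follow the
      neighbours of a single point. These are handled by the first item applied
      to a singleton ([orbit_envelope]). There is no circularity: the radius
      within which [B] must lie is chosen after [F]. *)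

Set Implicit Arguments.
Unset Strict Implicit.
Unset Printing Implicit Defensive.

Import Order.TTheory GRing.Theory Num.Theory.
Import numFieldNormedType.Exports.

Local Open Scope classical_set_scope.
Local Open Scope ring_scope.

(** * Upper means of sequences *)

Section upper_limit.
Context {R : realType}.
Implicit Types (u : nat -> \bar R) (c : \bar R).

Lemma near_lt_limn_esup u c :
  (limn_esup u < c)%E -> \forall n \near \oo, (u n < c)%E.
Proof.
move=> /ereal_inf_lt[_ [V oV <-]] Vc.
apply: filterS oV => n Vn; apply: le_lt_trans Vc.
by apply: ereal_sup_ubound; exists n.
Qed.

Lemma limn_esup_le_near u c :
  (\forall n \near \oo, (u n <= c)%E) -> (limn_esup u <= c)%E.
Proof.
move=> uc; pose V := [set n | (u n <= c)%E].
apply: (@le_trans _ _ (ereal_sup (u @` V))).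
  by apply: ereal_inf_lbound; exists V.
by apply: ge_ereal_sup => _ [n Vn <-].
Qed.

Lemma le_limn_esup u v :
  (forall n, (u n <= v n)%E) -> (limn_esup u <= limn_esup v)%E.
Proof.
move=> uv; apply: le_ereal_inf_tmp => _ [V oV <-].
apply: (@le_trans _ _ (ereal_sup (u @` V))).
  by apply: ereal_inf_lbound; exists V.
apply: ge_ereal_sup => _ [n Vn <-]; apply: le_trans (uv n) _.
by apply: ereal_sup_ubound; exists n.
Qed.

Definition average (g : nat -> R) (n : nat) : R := n%:R^-1 * \sum_(i < n) g i.

(** Working with a bound that holds eventually, rather than with the upper
    limit, makes sums of such sequences immediate to handle. *)
Definition mean_lt (g : nat -> R) (e : R) : Prop :=
  \forall n \near \oo, average g n < e.

Lemma mean_ltD (g h : nat -> R) (a b : R) :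
  mean_lt g a -> mean_lt h b -> mean_lt (g \+ h) (a + b).
Proof.
move=> ga hb; near=> n.
rewrite /average big_split /= mulrDr; apply: ltrD.
- by near: n.
- by near: n.
Unshelve. all: by end_near. Qed.

Lemma mean_lt0 (e : R) : 0 < e -> mean_lt (fun=> 0) e.
Proof. by move=> e0; near=> n; rewrite /average big1// mulr0.
Unshelve. all: by end_near. Qed.

End upper_limit.

(** * Diam-mean equicontinuity and envelopes *)

Section envelope.
Context {R : realType} {Z : metricType R}.
Variable f : Z -> Z.

Lemma diam_ge (A : set Z) x y : A x -> A y -> ((mdist x y)%:E <= diam A)%E.
Proof. by move=> Ax Ay; apply: ereal_sup_ubound; exists (x, y). Qed.

Lemma diam_le_radius (A : set Z) x (r : R) :
  (forall y, A y -> mdist x y <= r) -> (diam A <= (r *+ 2)%:E)%E.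
Proof.
move=> Ar; apply: ge_ereal_sup => _ [[y z] [/= Ay Az] <-].
rewrite lee_fin (le_trans (metric_triangle y x z))// mulr2n lerD ?Ar//.
by rewrite metric_sym Ar.
Qed.

Lemma diam_mean_equicontinuous_at_mean (x : Z) :
  diam_mean_equicontinuous_at f x -> mean_equicontinuous_at f x.
Proof.
move=> dfx e /dfx[U /nbhs_ballP[d /= d0]]; rewrite ballEmdist => dU Ue.
exists d => // y xyd; apply: le_lt_trans Ue; apply: le_limn_esup => n.
rewrite EFinM -sumEFin; apply: lee_wpmul2l; first by rewrite lee_fin invr_ge0.
apply: lee_sum => i _; apply: diam_ge; last by exists y => //; exact: dU.
by exists x => //; apply: dU; rewrite /= mdistxx.
Qed.

Definition orbit_envelope_at (x : Z) (e : R) : Prop :=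
  exists d g, [/\ 0 < d, mean_lt g e &
    forall y i, mdist x y < d -> mdist (iter i f x) (iter i f y) <= g i].

Lemma envelope_diam_mean_equicontinuous_at (x : Z) :
  (forall e, 0 < e -> orbit_envelope_at x e) ->
  diam_mean_equicontinuous_at f x.
Proof.
move=> xE e e0.
(* One factor 1/2 pays for passing from radius to diameter, another one for
   recovering a strict inequality in the limit. *)
have e4 : 0 < e / 4 by rewrite divr_gt0.
have [d [g [d0 ge gE]]] := xE _ e4.
exists [set y | mdist x y < d].
  by rewrite -ballEmdist; apply: nbhsx_ballx.
apply: (@le_lt_trans _ _ (e / 2)%:E); last first.
  by rewrite lte_fin ltr_pdivrMr// ltr_pMr// ltr1n.
apply: limn_esup_le_near; near=> n.
apply: (@le_trans _ _ ((n%:R^-1)%:E * \sum_(i < n) (g i *+ 2)%:E)%E).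
  apply: lee_wpmul2l; first by rewrite lee_fin invr_ge0.
  apply: lee_sum => i _; apply: (@diam_le_radius _ (iter i f x)).
  by move=> _ [y xy <-]; exact: gE.
rewrite sumEFin -EFinM lee_fin sumrMnl mulrnAr.
have -> : e / 2 = (e / 4) *+ 2 by rewrite [RHS]mulr2n; lra.
by rewrite lerMn2r/=; apply/ltW; near: n.
Unshelve. all: by end_near. Qed.

End envelope.

(** * Finite nets and thickenings *)

Section thickening.
Context {R : realType} {X : metricType R}.
Implicit Types (A B : set X) (x y : X).

Lemma dist_to_lt x B (e : R) :
  B !=set0 -> dist_to x B < e -> exists2 y, B y & mdist x y < e.
Proof.
move=> [b Bb] xB.
have [||_ [y By <-] xye] := @inf_lt _ [set mdist x y | y in B] e.
- by exists (mdist x b), b.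
- exact: xB.
by exists y.
Qed.

Lemma dist_to_set1 x y : dist_to x [set y] = mdist x y.
Proof.
apply/eqP; rewrite eq_le dist_to_le//=.
by apply: le_dist_to => [|_ ->//]; exists y.
Qed.

Lemma excess_set1 x y : excess [set x] [set y] = mdist x y.
Proof. by rewrite /excess image_set1 sup1 dist_to_set1. Qed.

Definition thickening A (r : R) : set X := [set x | dist_to x A <= r].

Lemma thickening_closed A (r : R) : A !=set0 -> closed (thickening A r).
Proof.
move=> A0 x clx; apply/ler_addgt0Pr => e e0.
have [y []] := clx _ (nbhsx_ballx x e e0).
rewrite ballEmdist /thickening /= => yA xy.
rewrite -lerBlDr; apply: le_trans yA.
apply: le_dist_to => // z Az; rewrite lerBlDl.
apply: le_trans (dist_to_le x Az) _.
by rewrite (le_trans (metric_triangle x y z))// lerD2r ltW.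
Qed.

Lemma sub_thickening A (r : R) : 0 <= r -> A `<=` thickening A r.
Proof.
move=> r0 x Ax.
by rewrite /thickening /= (le_trans (dist_to_le x Ax))// mdistxx.
Qed.

Lemma compact_finite_net A (r : R) : compact A -> A !=set0 -> 0 < r ->
  exists s : seq X, [/\ [set` s] `<=` A, [set` s] !=set0 &
    forall x, A x -> exists2 y, y \in s & mdist x y < r].
Proof.
move=> cA [a Aa] r0.
(* compact_cover speaks of pointed spaces, hence the base point. *)
pose P : ptopologicalType := HB.pack X (isPointed.Build X a).
have : @cover_compact P A by rewrite -compact_cover.
move=> /(_ X A (fun y => (ball y r)^°))[y _|x Ax|D DA Acov].
- exact: open_interior.
- by exists x => //; rewrite /interior; exact: nbhsx_ballx.
have net x : A x -> exists2 y, y \in (D : seq X) & mdist x y < r.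
  move=> /Acov[y Dy /interior_subset]; rewrite ballEmdist /= => yx.
  by exists y => //; rewrite metric_sym.
exists D; split => //.
- by move=> y /DA /set_mem.
- by have [y Dy _] := net _ Aa; exists y.
Qed.

End thickening.

(** * Envelopes in the hyperspace *)

Section hyperspace_envelope.
Context {R : realType} {X : metricType R} (cX : compact [set: X]).
Variables (T : X -> X) (cT : continuous T).
Notation K := (hyperspace cX).
Notation TK := (hyperspace_map cX cT).
Implicit Types (A B : K) (x y : X).

Lemma hyperset_iter i A : hyperset (iter i TK A) = iter i T @` A.
Proof. by elim: i => [|i IH] /=; rewrite ?image_id// IH image_comp. Qed.

Lemma excess_le_mdist A B : excess A B <= mdist A B.
Proof. by rewrite hyperspace_mdistE le_max lexx. Qed.

Lemma mdist_le A B (r : R) :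
  (forall x, hyperset A x -> dist_to x B <= r) ->
  (forall x, hyperset B x -> dist_to x A <= r) ->
  mdist A B <= r.
Proof.
move=> AB BA; rewrite hyperspace_mdistE ge_max.
by rewrite !excess_le//; exact: hyperset_nonempty.
Qed.

Lemma dist_to_le_mdist x A B : hyperset A x -> dist_to x B <= mdist A B.
Proof.
move=> Ax; apply: le_trans (excess_le_mdist A B).
exact: (le_excess cX Ax (hyperset_nonempty B)).
Qed.

Lemma excess_subset (A B C : set X) :
  A !=set0 -> C !=set0 -> A `<=` B -> excess A C <= excess B C.
Proof.
by move=> A0 C0 AB; apply: excess_le => // x /AB Bx; exact: (le_excess cX).
Qed.

Definition hyperpoint x : K.
Proof.
exists [set x]; last by exists x.
exact/accessible_closed_set1/hausdorff_accessible/metric_hausdorff.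
Defined.

Definition hyperthickening A (r : R) (r0 : 0 <= r) : K.
Proof.
exists (thickening A r); first exact/thickening_closed/hyperset_nonempty.
have [x Ax] := hyperset_nonempty A.
by exists x; exact: sub_thickening.
Defined.

Definition hyperfinite (s : seq X) (s0 : [set` s] !=set0) : K.
Proof.
exists [set` s] => //.
apply: compact_closed; first exact: metric_hausdorff.
exact/finite_compact/finite_seq.
Defined.

Lemma mdist_hyperpoint x y : mdist (hyperpoint x) (hyperpoint y) = mdist x y.
Proof.
by rewrite hyperspace_mdistE /hausdorff_dist !excess_set1 metric_sym maxxx.
Qed.

(** The excess over [A] is monotone in the first argument, so among the sets
    close to [A] the closed thickening of [A] is the worst one, and mean
    equicontinuity at [A] applies to it. *)
Lemma excess_image_envelope A (e : R) :
  mean_equicontinuous_at TK A -> 0 < e ->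
  exists d g, [/\ 0 < d, mean_lt g e & forall B i, mdist A B < d ->
    excess (iter i T @` B) (iter i T @` A) <= g i].
Proof.
move=> mA e0; have [d d0 Ad] := mA e e0.
have r0 : 0 <= d / 2 by rewrite divr_ge0// ltW.
pose C := hyperthickening A r0.
exists (d / 2), (fun i => mdist (iter i TK A) (iter i TK C)); split.
- by rewrite divr_gt0.
- have AC : mdist A C < d.
    apply: (@le_lt_trans _ _ (d / 2)); last first.
      by rewrite ltr_pdivrMr// ltr_pMr// ltr1n.
    apply: mdist_le => // x Ax.
    by apply: le_trans (dist_to_le x (sub_thickening r0 Ax)) _; rewrite mdistxx.
  by apply: filterS (near_lt_limn_esup (Ad _ AC)) => n; rewrite lte_fin.
- move=> B i AB; rewrite metric_sym.
  apply: le_trans (excess_le_mdist _ _); rewrite !hyperset_iter.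
  have BC : hyperset B `<=` C.
    move=> x Bx; apply: le_trans (dist_to_le_mdist A Bx) _.
    by rewrite metric_sym ltW.
  apply: excess_subset; last exact: image_subset.
  + exact/image_nonempty/hyperset_nonempty.
  + exact/image_nonempty/hyperset_nonempty.
Qed.

(** The previous lemma at a singleton, where the excess between the images of
    two singletons is the distance of two orbits. *)
Lemma orbit_envelope x (e : R) :
  mean_equicontinuous TK -> 0 < e -> orbit_envelope_at T x e.
Proof.
move=> mT e0.
have [d [g [d0 ge gE]]] := excess_image_envelope (mT (hyperpoint x)) e0.
exists d, g; split => // y i xy.
have := gE (hyperpoint y) i; rewrite mdist_hyperpoint => /(_ xy).
by rewrite !image_set1 excess_set1 metric_sym.
Qed.

(** Summing the envelopes of finitely many points. Nonnegativity is part of the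
    conclusion because each summand must stay below the sum. *)
Lemma seq_orbit_envelope (s : seq X) (e : R) :
  mean_equicontinuous TK -> 0 < e ->
  exists d g, [/\ 0 < d, mean_lt g e, forall i, 0 <= g i &
    forall x y i, x \in s -> mdist x y < d ->
      mdist (iter i T x) (iter i T y) <= g i].
Proof.
move=> mT; elim: s e => [|x s IH] e e0.
  by exists 1, (fun=> 0); split => //; exact: mean_lt0.
have e2 : 0 < e / 2 by rewrite divr_gt0.
have [d [g [d0 ge g0 gE]]] := IH _ e2.
have [c [h [c0 he hE]]] := orbit_envelope x mT e2.
have h0 i : 0 <= h i.
  by rewrite -(mdistxx (iter i T x)); apply: hE; rewrite mdistxx.
exists (Num.min c d), (h \+ g); split => [|||z y i].
- by rewrite lt_min c0.
- by rewrite [e]splitr; exact: mean_ltD.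
- by move=> i; rewrite addr_ge0.
- rewrite inE lt_min => /orP[/eqP ->|zs] /andP[zc zd] /=.
  + by rewrite (le_trans (hE _ _ _))// lerDl.
  + by rewrite (le_trans (gE _ _ _ zs _))// lerDr.
Qed.

(** A finite set close to [A] mediates between [A] and [B]: its orbit follows
    that of [A] by mean equicontinuity at [A], and its finitely many points
    each have a neighbour in [B]. *)
Lemma image_excess_envelope A (e : R) :
  mean_equicontinuous TK -> 0 < e ->
  exists d g, [/\ 0 < d, mean_lt g e & forall B i, mdist A B < d ->
    excess (iter i T @` A) (iter i T @` B) <= g i].
Proof.
move=> mT e0; have e2 : 0 < e / 2 by rewrite divr_gt0.
have [d d0 Ad] := mT A _ e2.
have d2 : 0 < d / 2 by rewrite divr_gt0.
have cA : compact (hyperset A).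
  by apply: subclosed_compact cX _ => //; exact: hyperset_closed.
have [s [sA s0 net]] := compact_finite_net cA (hyperset_nonempty A) d2.
pose F := hyperfinite s0.
have AF : mdist A F < d.
  apply: (@le_lt_trans _ _ (d / 2)); last first.
    by rewrite ltr_pdivrMr// ltr_pMr// ltr1n.
  apply: mdist_le => x; last first.
    by move=> /sA Ax; rewrite (le_trans (dist_to_le x Ax))// mdistxx ltW.
  move=> /net[y ys xy]; apply: le_trans (ltW xy).
  exact: (@dist_to_le _ _ x y F).
have [c [g [c0 ge g0 gE]]] := seq_orbit_envelope s mT e2.
exists c, ((fun i => mdist (iter i TK A) (iter i TK F)) \+ g); split => //.
  rewrite [e]splitr; apply: mean_ltD => //.
  by apply: filterS (near_lt_limn_esup (Ad _ AF)) => n; rewrite lte_fin.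
move=> B i AB /=.
have im0 (C : K) : iter i T @` C !=set0.
  exact/image_nonempty/hyperset_nonempty.
apply: le_trans (excess_triangle cX (im0 A) (im0 F) (im0 B)) _.
apply: lerD; first by rewrite -!hyperset_iter excess_le_mdist.
apply: excess_le => // _ [x xs <-].
have [|y By xy] := @dist_to_lt _ _ x B c (hyperset_nonempty B).
  by apply: le_lt_trans AB; apply: dist_to_le_mdist; exact: sA.
apply: le_trans (gE x y i xs xy).
by apply: dist_to_le; exists y.
Qed.

Lemma hyperspace_orbit_envelope A (e : R) :
  mean_equicontinuous TK -> 0 < e -> orbit_envelope_at TK A e.
Proof.
move=> mT e0; have e2 : 0 < e / 2 by rewrite divr_gt0.
have [c [g [c0 ge gE]]] := excess_image_envelope (mT A) e2.
have [d [h [d0 he hE]]] := image_excess_envelope A mT e2.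
have g0 i : 0 <= g i.
  rewrite -(excess_refl cX (image_hyperset_nonempty (iter i T) A)).
  by apply: gE; rewrite mdistxx.
have h0 i : 0 <= h i.
  rewrite -(excess_refl cX (image_hyperset_nonempty (iter i T) A)).
  by apply: hE; rewrite mdistxx.
exists (Num.min c d), (g \+ h); split.
- by rewrite lt_min c0.
- by rewrite [e]splitr; exact: mean_ltD.
- move=> B i; rewrite lt_min => /andP[Bc Bd] /=.
  rewrite hyperspace_mdistE !hyperset_iter ge_max; apply/andP; split.
  + by rewrite (le_trans (hE _ _ Bd))// lerDr.
  + by rewrite (le_trans (gE _ _ Bc))// lerDl.
Qed.

End hyperspace_envelope.

(** * Mean and diam-mean equicontinuity of the hyperspace *)

Theorem corollary7p6 (R : realType) (X : metricType R)
    (cX : compact [set: X]) (X0 : [set: X] !=set0)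
    (T : X -> X) (cT : continuous T) :
  diam_mean_equicontinuous (hyperspace_map cX cT) <->
  mean_equicontinuous (hyperspace_map cX cT).
Proof.
split=> [dT A|mT A]; first exact: diam_mean_equicontinuous_at_mean.
apply: envelope_diam_mean_equicontinuous_at => e e0.
exact: hyperspace_orbit_envelope.
Qed.
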